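(* Let $k\geq 3$ and $r\geq 0$ be integers, let $n=(2r-1)(k-2)+r-1$ and $$Q(k,r)=\frac{1}{4}\left[(2k-1)^2+\sqrt{(2k-1)^4+16k(kn+1)}\right]^2.$$ Then there exists a simple $(\frac{q-1}{2},k;r)$ Heffter space for every prime power $q\equiv 2k+1 \pmod{4k}$ with $q>Q(k,r)$.
   Context: A $(v_r,b_k)$ configuration is a point-block incidence structure $(V,\mathcal{B})$ with $v$ points and $b$ blocks, each block a $k$-subset of $V$, any two distinct points in at most one common block, and every point in exactly $r$ blocks; it is resolvable if $\mathcal{B}$ partitions into $r$ parallel classes, each of which is a partition of $V$. A half-set of an abelian group $G$ is a subset $V$ with $V$ and $-V$ partitioning $G\setminus\{0\}$. A $(v,k;r)$ Heffter space over an abelian group $G$ is a resolvable $(v_r,b_k)$ configuration whose point set is a half-set of $G$ and whose blocks are all zero-sum in $G$. It is simple if every block can be ordered so that its partial sums are pairwise distinct. *)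

(* Defs.v *)
From HB Require Import structures.
From mathcomp Require Import all_boot all_order all_algebra.
From mathcomp Require Import reals.

Set Implicit Arguments.
Unset Strict Implicit.
Unset Printing Implicit Defensive.

Import Order.TTheory GRing.Theory Num.Theory.

Local Open Scope ring_scope.

Definition prime_power (q : nat) : Prop :=
  exists p m : nat, [/\ prime p, (0 < m)%N & q = (p ^ m)%N].

Definition configuration (T : finType) (V : {set T}) (B : {set {set T}})
    (v r b k : nat) : Prop :=
  [/\ #|V| = v,
      #|B| = b,
      {in B, forall A : {set T}, A \subset V /\ #|A| = k},
      {in V &, forall x y : T, x != y ->
         (#|[set A in B | (x \in A) && (y \in A)]| <= 1)%N}
    & {in V, forall x : T, #|[set A in B | x \in A]| = r}].

(* The members of P are the parallel classes. *)
Definition resolvable (T : finType) (V : {set T}) (B : {set {set T}})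
    (r : nat) : Prop :=
  exists P : {set {set {set T}}},
    [/\ partition P B,
        #|P| = r
      & {in P, forall C : {set {set T}}, partition C V}].

Definition half_set (G : finZmodType) (V : {set G}) : Prop :=
  [disjoint V & [set - x | x in V]] /\
  V :|: [set - x | x in V] = [set~ 0].

Definition zero_sum (G : finZmodType) (A : {set G}) : Prop :=
  \sum_(x in A) x = 0.

Definition heffter_space (G : finZmodType) (V : {set G}) (B : {set {set G}})
    (v k r : nat) : Prop :=
  [/\ exists b : nat, configuration V B v r b k,
      resolvable V B r,
      half_set V
    & {in B, forall A : {set G}, zero_sum A}].

(* For s = [:: x1; ...; xk] this is [:: x1; x1 + x2; ...; x1 + ... + xk]: the
   empty sum is not included, so a zero-sum block can have distinct partial
   sums. *)
Definition partial_sums (G : finZmodType) (s : seq G) : seq G :=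
  scanl +%R 0 s.

Definition simple_blocks (G : finZmodType) (B : {set {set G}}) : Prop :=
  {in B, forall A : {set G},
     exists s : seq G, perm_eq s (enum A) /\ uniq (partial_sums s)}.

(* An integer, not a natural number: it is negative for r = 0. *)
Definition heffter_n (k r : nat) : int :=
  (2 * r%:Z - 1) * (k%:Z - 2) + r%:Z - 1.

Definition heffter_Q (R : realType) (k r : nat) : R :=
  4^-1 * ((2 * k%:R - 1) ^+ 2
          + Num.sqrt ((2 * k%:R - 1) ^+ 4
                      + 16 * k%:R * (k%:R * (heffter_n k r)%:~R + 1))) ^+ 2.

(* Main.v *)
Require Import Defs.
From HB Require Import structures.
From mathcomp Require Import all_boot all_order all_algebra.
From mathcomp Require Import cyclic finfield.
From mathcomp Require Import ring lra zify.
From mathcomp Require Import reals.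

Set Implicit Arguments.
Unset Strict Implicit.
Unset Printing Implicit Defensive.

Import Order.TTheory GRing.Theory Num.Theory.

Local Open Scope ring_scope.

(** Write [q = 2 k t + 1] with [t] odd, let [g] generate the multiplicative
    group of the field [F] with [q] elements, and let [C_i] be the coset of
    [g ^ i] modulo the group [C] of [t]-th roots of unity.  As [t] is odd,
    [- C_i] is [C_(i + k)], so that [V = C_0 u ... u C_(k-1)] is a half-set.  If
    [b] is a zero-sum transversal of [C_0, ..., C_(k-1)], its multiples [b d] by
    the elements [d] of [C] partition [V]; two such transversals [b] and [c]
    give parallel classes whose blocks meet in at most one point as soon as the
    ratios [b_i / c_i] are distinct.

    The transversals are chosen greedily.  The elements [b_0, ..., b_(k-3)] only
    have to avoid few values; if [s] is their sum, [x = b_(k-2)] has to lie in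
    [C_(k-2)] with [x + s] in [- C_(k-1)], and to avoid at most
    [n = (2r-1)(k-2) + r-1] values.  So it suffices that the number [N] of [x]
    with [x] and [x + s] in prescribed cosets exceeds [n], and [q > Q(k, r)] is
    what this takes, given the Weil type bound
    [e^2 N >= q - (e-1)^2 sqrt q - 2 e] for [e = 2 k].

    That bound needs no character sums.  Let
    [(A_g f)(x) = sum_(c in C) f(x + g c)].  On functions of sum zero,
    [sum_g A_g = - t] and [sum_g |A_g f|^2 = t (q - t) |f|^2], the sums being
    over [g != 0].  Since [A_g] only depends on the coset of [g], the
    Cauchy-Schwarz inequality on one coset and on its complement bounds the norm
    of [A_g + 1/e] by [(e-1) sqrt q / e].  Finally [t N] is the inner product of
    the indicator of a coset with the image under [A_s] of another one. *)

Section FiniteSums.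

Variable I : finType.

Lemma cauchy_schwarz_sum (R : realDomainType) (P : pred I) (f g : I -> R) :
  (\sum_(i | P i) f i * g i) ^+ 2 <=
  (\sum_(i | P i) f i ^+ 2) * (\sum_(i | P i) g i ^+ 2).
Proof.
have lagrange : \sum_(i | P i) \sum_(j | P j) (f i * g j - f j * g i) ^+ 2 =
    ((\sum_(i | P i) f i ^+ 2) * (\sum_(i | P i) g i ^+ 2)
     - (\sum_(i | P i) f i * g i) ^+ 2) *+ 2.
  set a := \sum_(i | P i) f i ^+ 2; set b := \sum_(i | P i) g i ^+ 2.
  set c := \sum_(i | P i) f i * g i.
  have -> : (a * b - c ^+ 2) *+ 2 = a * b + b * a - c * c *+ 2 by ring.
  rewrite !big_distrlr -sumrMnl -big_split -sumrB; apply: eq_bigr => i _ /=.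
  by rewrite -sumrMnl -big_split -sumrB; apply: eq_bigr => j _ /=; ring.
rewrite -subr_ge0 -(pmulrn_lge0 _ (ltn0Sn 1)) -lagrange.
by do 2![apply: sumr_ge0 => ? _]; apply: sqr_ge0.
Qed.

Lemma cauchy_schwarz_sum_sqrt (R : rcfType) (P : pred I) (f g : I -> R) :
  `|\sum_(i | P i) f i * g i| <=
  Num.sqrt (\sum_(i | P i) f i ^+ 2) * Num.sqrt (\sum_(i | P i) g i ^+ 2).
Proof.
rewrite -sqrtr_sqr -sqrtrM; last by apply: sumr_ge0 => i _; apply: sqr_ge0.
exact/ler_wsqrtr/cauchy_schwarz_sum.
Qed.

Lemma sqr_sum_le (R : realDomainType) (A : {set I}) (f : I -> R) :
  (\sum_(i in A) f i) ^+ 2 <= #|A|%:R * \sum_(i in A) f i ^+ 2.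
Proof.
have := cauchy_schwarz_sum (mem A) (fun=> 1) f.
rewrite (eq_bigr f) => [|i _]; last exact: mul1r.
by rewrite [X in X * _](eq_bigr (fun=> 1)) ?sumr_const // => i _; apply: expr1n.
Qed.

Lemma sqr_sum_le_of_sum_eq0 (R : realDomainType) (A D : {set I}) (f : I -> R) :
  A \subset D -> \sum_(i in D) f i = 0 ->
  #|D|%:R * (\sum_(i in A) f i) ^+ 2 <=
  #|A|%:R * #|D :\: A|%:R * \sum_(i in D) f i ^+ 2.
Proof.
move=> /setIidPr DA sum0.
have sumD (h : I -> R) : \sum_(i in D) h i =
    \sum_(i in A) h i + \sum_(i in D :\: A) h i.
  by rewrite (big_setID A) DA.
have sum_compl : \sum_(i in A) f i = - \sum_(i in D :\: A) f i.
  by apply/eqP; rewrite -addr_eq0 -sumD sum0.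
have leA := ler_wpM2l (ler0n R #|D :\: A|) (sqr_sum_le A f).
have leDA := ler_wpM2l (ler0n R #|A|) (sqr_sum_le (D :\: A) f).
rewrite -sqrrN -sum_compl in leDA.
by rewrite -(cardsID A D) DA sumD natrD; lra.
Qed.

End FiniteSums.

Lemma sum_translate (G : finZmodType) (M : nmodType) (f : G -> M) y :
  \sum_x f (x + y) = \sum_x f x.
Proof. by rewrite [RHS](reindex_inj (addIr y)). Qed.

Lemma sum_line_punctured (F : finFieldType) (M : zmodType) (f : F -> M) x y :
  y != 0 -> \sum_(g | g != 0) f (x + g * y) = \sum_z f z - f x.
Proof.
move=> y0; have line_inj : injective (fun g => x + g * y).
  by move=> g h /addrI/(mulIf y0).
rewrite [\sum_z _](reindex_inj line_inj) [in RHS](bigD1 0) //= mul0r addr0.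
by rewrite [RHS]addrC addKr.
Qed.

Section Correlation.

Variables (R : comPzRingType) (G : finZmodType) (f : G -> R).

Definition correlation (d : G) : R := \sum_x f x * f (x + d).

Lemma correlation0 : correlation 0 = \sum_x f x ^+ 2.
Proof. by apply: eq_bigr => x _; rewrite addr0. Qed.

Lemma correlation_translate a b :
  \sum_x f (x + a) * f (x + b) = correlation (b - a).
Proof.
rewrite -[RHS](sum_translate _ a); apply: eq_bigr => x _.
by rewrite -addrA subrKC.
Qed.

Lemma sum_correlation : \sum_d correlation d = (\sum_x f x) ^+ 2.
Proof.
rewrite exchange_big expr2 mulr_suml; apply: eq_bigr => x _ /=.
rewrite -mulr_sumr -[in RHS](sum_translate f x); congr (_ * _).
by apply: eq_bigr => y _; rewrite addrC.
Qed.

End Correlation.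

(** * Cyclotomic classes *)

Lemma finField_prim_root (F : finFieldType) :
  exists g : F, #|F|.-1.-primitive_root g.
Proof.
have F_gt1 := finNzRing_gt1 F.
have F1_gt0 : (0 < #|F|.-1)%N by case: #|F| F_gt1.
have /hasP[g _ prim_g] : has #|F|.-1.-primitive_root (enum (predC1 (0 : F))).
  apply: has_prim_root => //; last by rewrite -cardE cardC1.
    apply/allP => x; rewrite mem_enum => x0; apply/unity_rootP/(mulIf x0).
    by rewrite -exprSr prednK ?(ltnW F_gt1) // expf_card mul1r.
  exact: enum_uniq.
by exists g.
Qed.

Lemma card_unity_roots (F : finFieldType) n (z : F) :
  n.-primitive_root z -> #|[set x : F | x ^+ n == 1]| = n.
Proof.
move=> prim_z; rewrite -[RHS]card_ord.
rewrite -(card_imset _ (f := fun i : 'I_n => z ^+ i)).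
  apply: eq_card => x; rewrite inE; apply/eqP/imsetP => [xn|[i _ ->]].
    by have [i ->] := prim_rootP prim_z xn; exists i.
  by rewrite exprAC (prim_expr_order prim_z) expr1n.
move=> i j /eqP; rewrite (eq_prim_root_expr prim_z) !modn_small // => /eqP.
exact: val_inj.
Qed.

(* For [t] dividing [#|F|.-1] and [a] nonzero this is the coset of [a] modulo
   the group of [t]-th roots of unity. *)
Definition cyclotomic_class (F : finFieldType) (t : nat) (a : F) : {set F} :=
  [set x | x ^+ t == a ^+ t].

Definition class_union (F : finFieldType) (t : nat) (a : seq F) : {set F} :=
  [set x | x ^+ t \in [seq y ^+ t | y <- a]].

Definition cyclotomic_number (F : finFieldType) (t : nat) (a b s : F) : nat :=
  #|[set x in cyclotomic_class t a | x + s \in cyclotomic_class t b]|.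

Section CyclotomicClasses.

Variables (F : finFieldType) (e t : nat).
Hypothesis cardF : #|F| = (e * t).+1.

Implicit Types a b c s x : F.

Local Notation C := (@cyclotomic_class F t).

Lemma index_order_gt0 : (0 < e)%N && (0 < t)%N.
Proof. by rewrite -muln_gt0 -ltnS -cardF finNzRing_gt1. Qed.

Lemma class_union0 (r : seq F) : 0 \notin r -> 0 \notin class_union t r.
Proof.
have /andP[_ t_gt0] := index_order_gt0.
apply: contra; rewrite inE => /mapP[x xr /esym/eqP].
by rewrite expr0n gtn_eqF // expf_eq0 t_gt0 => /eqP <-.
Qed.

Lemma cyclotomic_class_neq0 a x : a != 0 -> x \in C a -> x != 0.
Proof.
move=> a0 xC; have : 0 \notin class_union t [:: a].
  by rewrite class_union0 // inE eq_sym.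
by apply: contraNneq => <-; move: xC; rewrite !inE => /eqP->.
Qed.

Lemma class1_neq0 c : c \in C 1 -> c != 0.
Proof. exact/cyclotomic_class_neq0/oner_neq0. Qed.

Lemma exprM_class1 x c : c \in C 1 -> (x * c) ^+ t = x ^+ t.
Proof. by rewrite inE expr1n exprMn => /eqP->; rewrite mulr1. Qed.

Lemma mem_cyclotomic_classMr a x c : c \in C 1 -> (x * c \in C a) = (x \in C a).
Proof. by move=> cC; rewrite !inE exprM_class1. Qed.

Lemma mem_cyclotomic_class1 a x : a != 0 -> (x / a \in C 1) = (x \in C a).
Proof.
move=> a0; rewrite !inE exprMn exprVn expr1n.
by rewrite -(inj_eq (mulIf (expf_neq0 t a0))) divfK ?expf_neq0 // mul1r.
Qed.

Lemma oppr_cyclotomic_class a x : (- x \in C a) = (x \in C (- a)).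
Proof.
rewrite !inE [(- x) ^+ t]exprNn [(- a) ^+ t]exprNn.
by rewrite (can2_eq (signrMK t) (signrMK t)).
Qed.

Lemma card_cyclotomic_class a : a != 0 -> #|C a| = t.
Proof.
move=> a0; have /andP[e_gt0 _] := index_order_gt0.
have [g prim_g] := finField_prim_root F; rewrite cardF /= in prim_g.
have := card_unity_roots (dvdn_prim_root prim_g (dvdn_mull e (dvdnn t))).
have -> : [set x : F | x ^+ t == 1] = C 1.
  by apply/setP => x; rewrite !inE expr1n.
move=> cardC1; rewrite -[RHS]cardC1 -[RHS](card_imset _ (mulIf a0)).
apply: eq_card => x; rewrite -mem_cyclotomic_class1 //.
apply/idP/imsetP => [xC|[c cC ->]]; last by rewrite mulfK.
by exists (x / a); rewrite ?divfK.
Qed.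

Lemma cyclotomic_number_le a b s : a != 0 -> (cyclotomic_number t a b s <= t)%N.
Proof.
move=> a0; rewrite -[leqRHS](card_cyclotomic_class a0).
by apply/subset_leq_card/subsetP => x /setIdP[].
Qed.

End CyclotomicClasses.

(** * Class sums and the cyclotomic numbers *)

Section ClassSums.

Variables (R : realFieldType) (F : finFieldType) (e t : nat).
Hypothesis cardF : #|F| = (e * t).+1.

Implicit Types (f : F -> R) (a c d g h x y : F).

Local Notation C := (@cyclotomic_class F t).
Local Notation q := (#|F|%:R : R).

Let e_neq0 : e%:R != 0 :> R.
Proof. by rewrite pnatr_eq0 -lt0n; have /andP[] := index_order_gt0 cardF. Qed.

Let qE : q = e%:R * t%:R + 1.
Proof. by rewrite cardF -natr1 natrM. Qed.

Let card_class a : a != 0 -> #|C a| = t := @card_cyclotomic_class F e t cardF a.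

Lemma sum_const_nonzero (z : R) : \sum_(g : F | g != 0) z = (q - 1) * z.
Proof. by rewrite sumr_const cardC1 cardF -natr1 addrK mulr_natl. Qed.

Definition class_sum f g x : R := \sum_(c in C 1) f (x + g * c).

Lemma eq_class_sum f g h x : h != 0 -> g \in C h ->
  class_sum f g x = class_sum f h x.
Proof.
move=> h0 gCh; rewrite -(mem_cyclotomic_class1 t g h0) in gCh.
rewrite /class_sum [RHS](reindex_inj (mulIf (class1_neq0 cardF gCh))).
apply: eq_big => c; first by rewrite mem_cyclotomic_classMr.
by rewrite mulrCA [h * _]mulrC divfK // mulrC.
Qed.

Section SumEq0.

Variable f : F -> R.
Hypothesis sumf : \sum_x f x = 0.

Lemma sum_correlation_line y :
  \sum_(g | g != 0) correlation f (g * y) =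
  ((y == 0)%:R * q - 1) * \sum_x f x ^+ 2.
Proof.
rewrite -correlation0; case: eqVneq => [->|y0].
  under eq_bigr do rewrite mulr0.
  by rewrite sum_const_nonzero mul1r.
under eq_bigr do rewrite -[_ * y]add0r.
rewrite sum_line_punctured // sum_correlation sumf.
by rewrite expr0n mul0r !sub0r mulN1r.
Qed.

Lemma sum_class_sum x : \sum_(g | g != 0) class_sum f g x = - (t%:R * f x).
Proof.
rewrite exchange_big /=.
under eq_bigr => c cC.
  rewrite sum_line_punctured ?(class1_neq0 cardF cC) // sumf sub0r; over.
by rewrite sumr_const card_class ?oner_neq0 // mulNrn mulr_natl.
Qed.

Lemma sum_class_sum_sqr :
  \sum_x \sum_(g | g != 0) class_sum f g x ^+ 2 =
  t%:R * (q - t%:R) * \sum_x f x ^+ 2.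
Proof.
have sqr_class_sum g : \sum_x class_sum f g x ^+ 2 =
    \sum_(c in C 1) \sum_(d in C 1) correlation f (g * (d - c)).
  under eq_bigr do rewrite expr2 big_distrlr.
  rewrite exchange_big; apply: eq_bigr => c _; rewrite exchange_big.
  by apply: eq_bigr => d _; rewrite correlation_translate mulrBr.
rewrite exchange_big /=; under eq_bigr do rewrite sqr_class_sum.
rewrite exchange_big /=.
transitivity (\sum_(c in C 1) (q - t%:R) * \sum_x f x ^+ 2).
  apply: eq_bigr => c cC; rewrite exchange_big /=.
  under eq_bigr do rewrite sum_correlation_line.
  rewrite -mulr_suml sumrB -mulr_suml sumr_const card_class ?oner_neq0 //.
  congr ((_ - _) * _); rewrite (bigD1 c) //= subrr eqxx big1 ?addr0 ?mul1r //.
  by move=> d /andP[_ dc]; rewrite subr_eq0 (negPf dc).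
by rewrite sumr_const card_class ?oner_neq0 // -[LHS]mulr_natl mulrA.
Qed.

End SumEq0.

(* The shift by [f x / e] makes the sum over the nonzero [g] vanish. *)
Definition balanced_class_sum f g x : R := class_sum f g x + f x / e%:R.

Lemma sum_balanced_class_sum f x : \sum_y f y = 0 ->
  \sum_(g | g != 0) balanced_class_sum f g x = 0.
Proof.
move=> sumf; rewrite big_split /= sum_class_sum // sum_const_nonzero qE.
by field.
Qed.

Lemma sum_balanced_class_sum_sqr f : \sum_x f x = 0 ->
  e%:R * \sum_x \sum_(g | g != 0) balanced_class_sum f g x ^+ 2 =
  t%:R * (e%:R - 1) * q * \sum_x f x ^+ 2.
Proof.
move=> sumf.
transitivity (e%:R * \sum_x (\sum_(g | g != 0) class_sum f g x ^+ 2
                             - t%:R / e%:R * f x ^+ 2)).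
  congr (_ * _); apply: eq_bigr => x _.
  under eq_bigr do rewrite sqrrD.
  rewrite !big_split /= -mulr_suml sum_class_sum // sum_const_nonzero qE.
  by field.
by rewrite sumrB sum_class_sum_sqr // -mulr_sumr qE; field.
Qed.

Lemma balanced_class_sum_sqr_le f h x : h != 0 -> \sum_y f y = 0 ->
  e%:R * t%:R * balanced_class_sum f h x ^+ 2 <=
  (e%:R - 1) * \sum_(g | g != 0) balanced_class_sum f g x ^+ 2.
Proof.
move=> h0 sumf; pose D := [set~ 0] : {set F}.
have DE (u : F -> R) : \sum_(g in D) u g = \sum_(g | g != 0) u g.
  by apply: eq_bigl => g; rewrite !inE.
have Ch_sub : C h \subset D.
  by apply/subsetP => g /(cyclotomic_class_neq0 cardF h0); rewrite !inE.
have sum0 : \sum_(g in D) balanced_class_sum f g x = 0.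
  by rewrite DE sum_balanced_class_sum.
have cardD : #|D| = (e * t)%N by rewrite cardsC1 cardF.
have := sqr_sum_le_of_sum_eq0 Ch_sub sum0.
rewrite DE (eq_bigr (fun=> balanced_class_sum f h x)) => [|g gC]; last first.
  by rewrite /balanced_class_sum (eq_class_sum _ _ h0 gC).
rewrite sumr_const cardsD (setIidPr Ch_sub) cardD card_class //.
have /andP[e_gt0 t_gt0] := index_order_gt0 cardF.
set z := balanced_class_sum f h x; set S := \sum_(g | _) _.
rewrite natrB ?leq_pmull // natrM -[z *+ t]mulr_natl exprMn => le_S.
have t2_gt0 : 0 < t%:R ^+ 2 :> R by rewrite exprn_gt0 ?ltr0n.
by rewrite -(ler_pM2l t2_gt0); move: le_S; lra.
Qed.

Lemma sum_sqr_balanced_class_sum_le f h : h != 0 -> \sum_x f x = 0 ->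
  e%:R ^+ 2 * \sum_x balanced_class_sum f h x ^+ 2 <=
  (e%:R - 1) ^+ 2 * q * \sum_x f x ^+ 2.
Proof.
move=> h0 sumf; have /andP[_ t_gt0] := index_order_gt0 cardF.
have t_gt0R : 0 < t%:R :> R by rewrite ltr0n.
have le_sum : e%:R * t%:R * \sum_x balanced_class_sum f h x ^+ 2 <=
    (e%:R - 1) * \sum_x \sum_(g | g != 0) balanced_class_sum f g x ^+ 2.
  rewrite !mulr_sumr; apply: ler_sum => x _.
  exact: balanced_class_sum_sqr_le.
rewrite -(ler_pM2l t_gt0R); have := ler_wpM2l (ler0n R e) le_sum.
rewrite [in leRHS]mulrCA sum_balanced_class_sum_sqr //.
by set S := \sum_x f x ^+ 2; set X := \sum_x _; lra.
Qed.

End ClassSums.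

Lemma normr_class_sum_form_le (R : rcfType) (F : finFieldType) (e t : nat)
    (phi psi : F -> R) (h : F) :
  #|F| = (e * t).+1 -> h != 0 -> \sum_x psi x = 0 ->
  e%:R * `|\sum_x phi x * class_sum t psi h x| <=
  ((e%:R - 1) * Num.sqrt #|F|%:R + 1) *
    (Num.sqrt (\sum_x phi x ^+ 2) * Num.sqrt (\sum_x psi x ^+ 2)).
Proof.
move=> cardF h0 sumpsi; have e_ge1 : 1 <= e%:R :> R.
  by rewrite ler1n; have /andP[] := index_order_gt0 cardF.
have e_neq0 : e%:R != 0 :> R by rewrite gt_eqF // (lt_le_trans ltr01).
have -> : \sum_x phi x * class_sum t psi h x =
    \sum_x phi x * balanced_class_sum e t psi h x
    - (\sum_x phi x * psi x) / e%:R.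
  rewrite mulr_suml -sumrB; apply: eq_bigr => x _.
  by rewrite /balanced_class_sum; ring.
pose bal := balanced_class_sum e t psi h.
have cs_bal := cauchy_schwarz_sum_sqrt xpredT phi bal.
have cs_psi := cauchy_schwarz_sum_sqrt xpredT phi psi.
have norm_bal : e%:R * Num.sqrt (\sum_x bal x ^+ 2) <=
    (e%:R - 1) * Num.sqrt #|F|%:R * Num.sqrt (\sum_x psi x ^+ 2).
  have := ler_wsqrtr (sum_sqr_balanced_class_sum_le cardF h0 sumpsi).
  rewrite sqrtrM ?sqr_ge0 // sqrtr_sqr ger0_norm ?ler0n //.
  rewrite sqrtrM ?(mulr_ge0 (sqr_ge0 _)) ?ler0n // sqrtrM ?sqr_ge0 // sqrtr_sqr.
  by rewrite ger0_norm // subr_ge0.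
apply: le_trans (ler_wpM2l (ler0n R e) (ler_normB _ _)) _.
rewrite [X in _ + X]normrM normfV normr_nat mulrDr mulrCA divff // mulr1.
rewrite mulrDl mul1r lerD //.
apply: le_trans (ler_wpM2l (ler0n R e) cs_bal) _.
by rewrite mulrCA [leRHS]mulrCA ler_wpM2l ?sqrtr_ge0.
Qed.


Section ClassIndicators.

Variables (R : realFieldType) (F : finFieldType) (e t : nat).
Hypothesis cardF : #|F| = (e * t).+1.

Implicit Types a b s x : F.

Local Notation C := (@cyclotomic_class F t).
Local Notation q := (#|F|%:R : R).

Let q_gt0 : 0 < q.
Proof. by rewrite cardF ltr0n. Qed.

Definition class_ind a x : R := (x \in C a)%:R.

Definition centered_class_ind a x : R := class_ind a x - t%:R / q.

Lemma sum_class_ind a : a != 0 -> \sum_x class_ind a x = t%:R.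
Proof.
move=> a0; rewrite -(card_cyclotomic_class cardF a0) -sum1_card natr_sum.
rewrite [RHS]big_mkcond; apply: eq_bigr => x _.
by rewrite /class_ind; case: ifP.
Qed.

Lemma sum_centered_class_ind a : a != 0 -> \sum_x centered_class_ind a x = 0.
Proof.
move=> a0; rewrite sumrB sum_class_ind // sumr_const -[X in _ - X]mulr_natl.
by field; rewrite gt_eqF.
Qed.

Lemma sum_centered_class_ind_sqr a : a != 0 ->
  \sum_x centered_class_ind a x ^+ 2 = t%:R * (1 - t%:R / q).
Proof.
move=> a0; transitivity (\sum_x ((1 - t%:R / q) * class_ind a x
                                 - t%:R / q * centered_class_ind a x)).
  apply: eq_bigr => x _; rewrite /centered_class_ind /class_ind.
  by case: (_ \in _) => /=; ring.
by rewrite sumrB -!mulr_sumr sum_class_ind // sum_centered_class_ind //; ring.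
Qed.

Lemma cyclotomic_number_sum a b s :
  t%:R * (cyclotomic_number t a b s)%:R =
  \sum_x class_ind a x * class_sum t (class_ind b) s x.
Proof.
under [RHS]eq_bigr => x _ do rewrite mulr_sumr.
rewrite exchange_big /= (eq_bigr (fun=> (cyclotomic_number t a b s)%:R)).
  by rewrite sumr_const (card_cyclotomic_class cardF) ?oner_neq0 // mulr_natl.
move=> c cC; have c0 := class1_neq0 cardF cC.
rewrite (reindex_inj (mulIf c0)) /cyclotomic_number -sum1_card natr_sum.
rewrite [RHS]big_mkcond; apply: eq_bigr => x _.
rewrite /class_ind inE -mulrDl !mem_cyclotomic_classMr //.
by rewrite -natrM mulnb; case: (_ && _).
Qed.

Lemma cyclotomic_number_centered a b s : a != 0 -> b != 0 ->
  t%:R * (cyclotomic_number t a b s)%:R =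
  \sum_x centered_class_ind a x * class_sum t (centered_class_ind b) s x
  + t%:R ^+ 3 / q.
Proof.
move=> a0 b0; rewrite cyclotomic_number_sum.
have sum_class_sum0 : \sum_x class_sum t (centered_class_ind b) s x = 0.
  rewrite exchange_big big1 //= => c _.
  by rewrite sum_translate sum_centered_class_ind.
transitivity (\sum_x (
    centered_class_ind a x * class_sum t (centered_class_ind b) s x
    + t%:R / q * class_sum t (centered_class_ind b) s x
    + t%:R ^+ 2 / q * class_ind a x)).
  apply: eq_bigr => x _.
  have -> : class_sum t (class_ind b) s x =
      class_sum t (centered_class_ind b) s x + t%:R ^+ 2 / q.
    rewrite /class_sum sumrB sumr_const.
    rewrite (card_cyclotomic_class cardF) ?oner_neq0 //.
    by rewrite -[X in _ - X]mulr_natl; ring.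
  by rewrite /centered_class_ind; ring.
rewrite !big_split /= -!mulr_sumr sum_class_sum0 sum_class_ind //.
by rewrite mulr0 addr0 mulrAC -exprSr.
Qed.

End ClassIndicators.

Section CyclotomicNumberEstimate.

Variables (R : rcfType) (F : finFieldType) (e t : nat) (a b s : F).
Hypothesis cardF : #|F| = (e * t).+1.
Hypotheses (a0 : a != 0) (b0 : b != 0) (s0 : s != 0).

Local Notation q := (#|F|%:R : R).

Lemma cyclotomic_number_estimate :
  e%:R * `|(cyclotomic_number t a b s)%:R - t%:R ^+ 2 / q| <=
  ((e%:R - 1) * Num.sqrt q + 1) * (1 - t%:R / q).
Proof.
have := normr_class_sum_form_le (centered_class_ind R t a) cardF s0
  (sum_centered_class_ind R cardF b0).
rewrite !(sum_centered_class_ind_sqr R cardF) // -expr2 sqr_sqrtr; last first.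
  rewrite -(sum_centered_class_ind_sqr R cardF a0).
  by apply: sumr_ge0 => x _; apply: sqr_ge0.
have /eqP := cyclotomic_number_centered R cardF s a0 b0.
rewrite -subr_eq => /eqP <-.
set N := (cyclotomic_number t a b s)%:R.
have -> : t%:R * N - t%:R ^+ 3 / q = t%:R * (N - t%:R ^+ 2 / q) by ring.
rewrite normrM normr_nat [leLHS]mulrCA [leRHS]mulrCA ler_pM2l // ltr0n.
by have /andP[] := index_order_gt0 cardF.
Qed.

Lemma cyclotomic_number_ge :
  q - (e%:R - 1) ^+ 2 * Num.sqrt q - 2 * e%:R <=
  e%:R ^+ 2 * (cyclotomic_number t a b s)%:R.
Proof.
have := cyclotomic_number_estimate; set N := (cyclotomic_number _ _ _ _)%:R.
set r := Num.sqrt q => estimate; have r2 : r ^+ 2 = q by rewrite sqr_sqrtr.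
have q_ge1 : 1 <= q by rewrite cardF ler1n.
have r_ge1 : 1 <= r by rewrite -sqrtr1 ler_wsqrtr.
have r_gt0 : 0 < r := lt_le_trans ltr01 r_ge1.
have e_ge1 : 1 <= e%:R :> R.
  by rewrite ler1n; have /andP[] := index_order_gt0 cardF.
have e_gt0 : 0 < e%:R :> R := lt_le_trans ltr01 e_ge1.
have lower : t%:R ^+ 2 / q - N <= `|N - t%:R ^+ 2 / q|.
  by rewrite -normrN opprB ler_norm.
have := le_trans (ler_wpM2l (ltW e_gt0) lower) estimate.
rewrite -(ler_pM2l e_gt0).
have -> : t%:R = (r ^+ 2 - 1) / e%:R.
  by rewrite r2 cardF -natr1 natrM; field; rewrite gt_eqF.
have gap : 0 <= (e%:R - 1) * (1 - r^-1) by rewrite mulr_ge0 ?subr_ge0 ?invf_le1.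
have -> : e%:R * (e%:R * (((r ^+ 2 - 1) / e%:R) ^+ 2 / q - N)) =
    r ^+ 2 - 2 + r ^- 2 - e%:R ^+ 2 * N.
  by rewrite -r2; field; rewrite !gt_eqF.
have -> : e%:R * (((e%:R - 1) * r + 1) * (1 - (r ^+ 2 - 1) / e%:R / q)) =
    (e%:R - 1) ^+ 2 * r + (e%:R - 1) / r + e%:R - 1 + r ^- 2.
  by rewrite -r2; field; rewrite !gt_eqF.
by rewrite -r2; lra.
Qed.

End CyclotomicNumberEstimate.

(* The hypothesis places [Num.sqrt x] beyond the larger root of
   [y^2 - a y - b]. *)
Lemma lt_sub_sqrt_of_root_lt (R : rcfType) (a b x : R) : 0 <= a ->
  4^-1 * (a + Num.sqrt (a ^+ 2 + 4 * b)) ^+ 2 < x -> b < x - a * Num.sqrt x.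
Proof.
move=> a_ge0; set d := a ^+ 2 + 4 * b => root_lt; have d_ge0 := sqrtr_ge0 d.
set y := Num.sqrt x; have y_ge0 : 0 <= y := sqrtr_ge0 x.
have y2 : y ^+ 2 = x.
  rewrite sqr_sqrtr // (le_trans _ (ltW root_lt)) //.
  by rewrite mulr_ge0 ?sqr_ge0 // invr_ge0.
have y_gt : Num.sqrt d < 2 * y - a.
  rewrite ltrBrDl -(ltr_pXn2r (n := 2)) ?nnegrE ?addr_ge0 ?mulr_ge0 //.
  by rewrite exprMn y2; move: root_lt; lra.
have d_lt : d < (2 * y - a) ^+ 2.
  have [d_gt0|d_le0] := ltrP 0 d.
    rewrite -(sqr_sqrtr (ltW d_gt0)) ltr_pXn2r ?nnegrE //.
    by rewrite (le_trans d_ge0) ?ltW.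
  by rewrite (le_lt_trans d_le0) // exprn_gt0 // (le_lt_trans d_ge0).
by rewrite -y2; move: d_lt; rewrite /d; lra.
Qed.

Lemma heffter_Q_bound (R : realType) (k r : nat) (x : R) :
  heffter_Q R k r < x ->
  (2 * k)%:R ^+ 2 * (heffter_n k r)%:~R <
  x - ((2 * k)%:R - 1) ^+ 2 * Num.sqrt x - 2 * (2 * k)%:R.
Proof.
rewrite /heffter_Q natrM; set n := _%:~R => Q_lt.
have radicand : (2 * k%:R - 1) ^+ 4 + 16 * k%:R * (k%:R * n + 1) =
    ((2 * k%:R - 1) ^+ 2) ^+ 2 + 4 * (4 * k%:R * (k%:R * n + 1)) :> R by ring.
by move: Q_lt; rewrite radicand => /(lt_sub_sqrt_of_root_lt (sqr_ge0 _)); lra.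
Qed.

Lemma heffter_n_lt_cyclotomic_number (R : realType) (F : finFieldType)
    (k r t : nat) (a b s : F) :
  #|F| = (2 * k * t).+1 -> heffter_Q R k r < #|F|%:R ->
  a != 0 -> b != 0 -> s != 0 ->
  heffter_n k r < (cyclotomic_number t a b s)%:Z.
Proof.
move=> cardF /heffter_Q_bound Q_lt a0 b0 s0.
have /andP[k2_gt0 _] := index_order_gt0 cardF.
have := lt_le_trans Q_lt (cyclotomic_number_ge R cardF a0 b0 s0).
by rewrite ltr_pM2l ?exprn_gt0 ?ltr0n // -[in X in _ -> X](ltr_int R).
Qed.

(** * Greedy construction of the base blocks *)

Lemma exists_notin_family (T : finType) (I : eqType) (A : {set T}) (s : seq T)
    (L : seq I) (bad : I -> seq T) (n : nat) :
    {in L, forall i, (size (bad i) <= n)%N} ->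
    (size s + size L * n < #|A|)%N ->
  exists x, [/\ x \in A, x \notin s & {in L, forall i, x \notin bad i}].
Proof.
move=> size_bad lt_A; pose forbidden := s ++ flatten [seq bad i | i <- L].
have size_forbidden : (size forbidden <= size s + size L * n)%N.
  rewrite size_cat leq_add2l.
  elim: L size_bad {lt_A forbidden} => //= i L IHL size_bad.
  rewrite size_cat mulSn leq_add ?size_bad ?mem_head // IHL // => j jL.
  by rewrite size_bad // inE jL orbT.
have /subsetPn[x xA] : ~~ (A \subset forbidden).
  apply: contraL lt_A => /subset_leq_card A_le; rewrite -leqNgt.
  exact: leq_trans A_le (leq_trans (card_size _) size_forbidden).
rewrite mem_cat negb_or => /andP[xs x_bad]; exists x; split=> // i iL.
by apply: contra x_bad => xi; apply/flatten_mapP; exists i.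
Qed.

Section PartialSums.

Variable G : finZmodType.

Implicit Types (s : seq G) (x : G).

Lemma partial_sums_rcons s x :
  partial_sums (rcons s x) = rcons (partial_sums s) (\sum_(y <- s) y + x).
Proof. by rewrite /partial_sums scanl_rcons foldl_rcons foldl_idx. Qed.

Lemma notin_partial_sums s x :
  x \notin [seq y - \sum_(z <- s) z | y <- partial_sums s] ->
  \sum_(z <- s) z + x \notin partial_sums s.
Proof.
apply: contra => sx; apply/mapP; exists (\sum_(z <- s) z + x) => //.
by rewrite addrC addKr.
Qed.

Lemma sum_neq0_partial_sums s :
  s != [::] -> uniq (0 :: partial_sums s) -> \sum_(y <- s) y != 0.
Proof.
case/lastP: s => // s x _.
rewrite partial_sums_rcons -rcons_cons rcons_uniq big_rcons => /andP[+ _].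
by rewrite in_cons negb_or => /andP[].
Qed.

Definition zero_sum_ext s x : seq G :=
  rcons (rcons s x) (- (\sum_(y <- s) y + x)).

Lemma sum_zero_sum_ext s x : \sum_(y <- zero_sum_ext s x) y = 0.
Proof. by rewrite !big_rcons /= subrr. Qed.

Lemma uniq_partial_sums_ext s x :
  uniq (0 :: partial_sums s) -> \sum_(y <- s) y + x != 0 ->
  \sum_(y <- s) y + x \notin partial_sums s ->
  uniq (partial_sums (zero_sum_ext s x)).
Proof.
move=> /andP[sums0 uniq_s] sx0 sx_new.
rewrite !partial_sums_rcons big_rcons /= subrr.
by rewrite !rcons_uniq mem_rcons in_cons negb_or eq_sym sx0 sums0 sx_new.
Qed.

End PartialSums.

Section Ratios.

Variable F : finFieldType.

Implicit Types (b c : seq F) (x y : F).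

Definition ratios b c : seq F := [seq yz.1 / yz.2 | yz <- zip b c].

Lemma size_ratios b c : size (ratios b c) = minn (size b) (size c).
Proof. by rewrite size_map size_zip. Qed.

Lemma ratios_rcons b c x : (size b < size c)%N ->
  ratios (rcons b x) c = rcons (ratios b c) (x / c`_(size b)).
Proof.
rewrite /ratios; elim: b c => [|y b IHb] [|z c] //= lt_bc; last by rewrite IHb.
by case: c {lt_bc}.
Qed.

Lemma nth_ratios b c i : size b = size c -> (i < size b)%N ->
  (ratios b c)`_i = b`_i / c`_i.
Proof.
by move=> bc ib; rewrite (nth_map (0, 0)) ?nth_zip //= size_zip -bc minnn.
Qed.

Lemma ratiosC_uniq b c : uniq (ratios b c) = uniq (ratios c b).
Proof.
rewrite -(map_inj_uniq invr_inj) /ratios -map_comp; congr uniq.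
by elim: b c => [|y b IHb] [|z c] //=; rewrite IHb invf_div.
Qed.

Definition distinct_ratios b c : bool := uniq (ratios b c).

(* In order: the [x] for which the last two ratios of [zero_sum_ext b x] to [c]
   coincide, and those for which the last but one, respectively the last,
   repeats a ratio of [b] to [c]. *)
Definition ratio_clashes b c : seq F :=
  let s := \sum_(y <- b) y in let u := c`_(size b) in let v := c`_(size b).+1 in
  - s * u / (v + u) ::
    [seq z * u | z <- ratios b c] ++ [seq - (s + z * v) | z <- ratios b c].

Lemma size_ratio_clashes b c :
  (size (ratio_clashes b c) <= (size b).*2.+1)%N.
Proof.
rewrite /ratio_clashes /= ltnS size_cat !size_map size_zip.
by rewrite -addnn leq_add ?geq_minl.
Qed.

Lemma uniq_ratios_ext b c x : 0 \notin c -> size c = (size b).+2 ->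
  \sum_(y <- b) y != 0 -> uniq (ratios b c) -> x \notin ratio_clashes b c ->
  uniq (ratios (zero_sum_ext b x) c).
Proof.
move=> c0 size_c; rewrite /ratio_clashes.
set s := \sum_(y <- b) y => s0 uniq_bc.
set u := c`_(size b); set v := c`_(size b).+1.
have u0 : u != 0 by apply: contraNneq c0 => <-; rewrite mem_nth ?size_c.
have v0 : v != 0 by apply: contraNneq c0 => <-; rewrite mem_nth ?size_c.
rewrite in_cons mem_cat !negb_or => /and3P[clash_xy clash_x clash_y].
rewrite !ratios_rcons ?size_rcons ?size_c // !rcons_uniq uniq_bc andbT.
rewrite mem_rcons in_cons negb_or -andbA -/s -/u -/v; apply/and3P; split.
- apply: contra clash_xy => /eqP/esym/eqP; rewrite eqr_div // => /eqP xyE.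
  have xE : x * (v + u) = - s * u by rewrite mulrDr xyE; ring.
  rewrite -xE mulfK //; apply: contra_eqN xE => /eqP->.
  by rewrite mulr0 eq_sym mulf_neq0 ?oppr_eq0.
- apply: contra clash_y => y_ratio; apply/mapP; eexists; first exact: y_ratio.
  by rewrite divfK //; ring.
apply: contra clash_x => x_ratio; apply/mapP; exists (x / u) => //.
by rewrite divfK.
Qed.

End Ratios.

Section BaseBlocks.

Variables (F : finFieldType) (e t : nat).
Hypothesis cardF : #|F| = (e * t).+1.

Implicit Types (a b c : seq F) (L : seq (seq F)) (s u v x y : F).

Local Notation C := (@cyclotomic_class F t).

Definition class_transversal a b : Prop :=
  [seq y ^+ t | y <- b] = [seq x ^+ t | x <- a].

Lemma class_transversal_size a b : class_transversal a b -> size b = size a.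
Proof. by move/(congr1 size); rewrite !size_map. Qed.

Lemma class_transversal_rcons a b x y : class_transversal a b -> y \in C x ->
  class_transversal (rcons a x) (rcons b y).
Proof. by rewrite /class_transversal !map_rcons inE => -> /eqP ->. Qed.

Lemma class_union_transversal a b :
  class_transversal a b -> class_union t b = class_union t a.
Proof. by rewrite /class_union => ->. Qed.

Lemma class_transversal_neq0 a b :
  0 \notin a -> class_transversal a b -> 0 \notin b.
Proof.
move=> a0 /class_union_transversal eq_ab.
by apply: contra (class_union0 cardF a0); rewrite -eq_ab inE; apply: map_f.
Qed.

Definition base_block a b : Prop :=
  [/\ class_transversal a b, \sum_(y <- b) y = 0 & uniq (partial_sums b)].

Lemma exists_simple_transversal L a :
    0 \notin a -> {in L, forall c, 0 \notin c /\ (size a <= size c)%N} ->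
    (size a * (size L).+1 < t)%N ->
  exists b, [/\ class_transversal a b, uniq (0 :: partial_sums b)
              & {in L, forall c, uniq (ratios b c)}].
Proof.
elim/last_ind: a => [|a x IHa].
  by exists [::]; split=> // c _; case: c.
rewrite mem_rcons in_cons negb_or eq_sym => /andP[x0 a0].
rewrite size_rcons => L_ge lt_t.
have [||b [ab uniq_b ratios_b]] := IHa a0.
- by move=> c /L_ge[c0 /ltnW].
- by apply: leq_ltn_trans lt_t; rewrite leq_mul2r leqnSn orbT.
have size_b := class_transversal_size ab; set s := \sum_(y <- b) y.
pose clashes c := [seq z * c`_(size b) | z <- ratios b c].
have [||y [yC y_sums y_clash]] := @exists_notin_family _ _ (C x)
    [seq z - s | z <- 0 :: partial_sums b] L clashes (size a).
- by move=> c cL; rewrite size_map size_ratios size_b geq_minl.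
- rewrite size_map /= size_scanl size_b (card_cyclotomic_class cardF) //.
  by apply: leq_ltn_trans lt_t; rewrite mulSn mulnS; nia.
exists (rcons b y); split; first exact: class_transversal_rcons.
  rewrite partial_sums_rcons -rcons_cons rcons_uniq uniq_b andbT.
  apply: contra y_sums => sy; apply/mapP; exists (s + y) => //.
  by rewrite addrC addKr.
move=> c cL; have [c0 lt_c] := L_ge c cL; rewrite -size_b in lt_c.
rewrite ratios_rcons // rcons_uniq ratios_b // andbT.
apply: contra (y_clash c cL) => y_ratio.
apply/mapP; exists (y / c`_(size b)) => //.
by rewrite divfK //; apply: contraNneq c0 => <-; apply: mem_nth.
Qed.

Lemma exists_base_block L a u v :
    a != [::] -> 0 \notin rcons (rcons a u) v ->
    {in L, forall c, 0 \notin c /\ size c = (size a).+2} ->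
    (forall s, s != 0 ->
       (size a + size L * (size a).*2.+1 < cyclotomic_number t u (- v) s)%N) ->
  exists2 b, base_block (rcons (rcons a u) v) b
           & {in L, forall c, uniq (ratios b c)}.
Proof.
rewrite !(mem_rcons, in_cons) !negb_or ![0 == _]eq_sym.
move=> a_neq0 /and3P[v0 u0 a0] L_size many.
have [||b [ab uniq_b ratios_b]] := @exists_simple_transversal L a a0.
- by move=> c /L_size[c0 ->]; split=> //; lia.
- have := leq_trans (many 1 (oner_neq0 F)) (cyclotomic_number_le cardF _ _ u0).
  by nia.
have size_b := class_transversal_size ab; rewrite -size_b in L_size many.
set s := \sum_(y <- b) y; have s0 : s != 0.
  by apply: sum_neq0_partial_sums uniq_b; rewrite -size_eq0 size_b size_eq0.
have [||x [/setIdP[xC xsC] x_sums x_clash]] := @exists_notin_family _ _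
    [set x in C u | x + s \in C (- v)] [seq z - s | z <- partial_sums b] L
    (ratio_clashes b) (size b).*2.+1.
- by move=> c _; apply: size_ratio_clashes.
- by rewrite size_map size_scanl many.
have yC : - (s + x) \in C v by rewrite oppr_cyclotomic_class addrC.
exists (zero_sum_ext b x).
  split; [|exact: sum_zero_sum_ext|].
  - exact: class_transversal_rcons (class_transversal_rcons ab xC) yC.
  - apply: uniq_partial_sums_ext (notin_partial_sums x_sums) => //.
    by rewrite -oppr_eq0 (cyclotomic_class_neq0 cardF v0 yC).
move=> c cL; have [c0 size_c] := L_size c cL.
by apply: uniq_ratios_ext (x_clash c cL) => //; apply: ratios_b.
Qed.

(* The bound is [heffter_n (size a).+2 n < cyclotomic_number t u (- v) s]
   without subtraction; for [n = 0] it always holds. *)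
Lemma exists_base_blocks a u v n :
    a != [::] -> 0 \notin rcons (rcons a u) v ->
    (forall s, s != 0 ->
       (n * (size a).*2.+1 <= cyclotomic_number t u (- v) s + size a)%N) ->
  exists L, [/\ size L = n, {in L, forall b, base_block (rcons (rcons a u) v) b}
              & pairwise (@distinct_ratios F) L].
Proof.
move=> a_neq0 reps0; elim: n => [|n IHn] many; first by exists [::].
have [|L [size_L base_L ratios_L]] := IHn.
  by move=> s s0; apply: leq_trans (many s s0); rewrite leq_mul2r leqnSn orbT.
have [||b base_b ratios_b] := @exists_base_block L a u v a_neq0 reps0.
- move=> c /base_L[/[dup]/(class_transversal_neq0 reps0) c0].
  by move/class_transversal_size; rewrite !size_rcons.
- by move=> s s0; rewrite size_L; have := many s s0; rewrite mulSn; lia.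
exists (b :: L); split=> /=; first by rewrite size_L.
  by move=> c; rewrite in_cons => /predU1P[->|/base_L].
by rewrite ratios_L andbT; apply/allP.
Qed.

End BaseBlocks.

(** * Configurations from parallel classes *)

Section ParallelClasses.

Variables (T I : finType) (V : {set T}) (P : I -> {set {set T}}) (k : nat).
Hypothesis V_neq0 : V != set0.
Hypothesis partP : forall i, partition (P i) V.
Hypothesis k_gt1 : (1 < k)%N.
Hypothesis cardP : forall i A, A \in P i -> #|A| = k.
Hypothesis meetP : forall i j A B,
  i != j -> A \in P i -> B \in P j -> (#|A :&: B| <= 1)%N.

Local Notation blocks := (\bigcup_i P i).

Lemma parallel_class_uniq i j A : A \in P i -> A \in P j -> i = j.
Proof.
move=> Ai Aj; apply/eqP; apply: contraTT k_gt1 => neq_ij.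
by rewrite -leqNgt -(cardP Ai); have := meetP neq_ij Ai Aj; rewrite setIid.
Qed.

Lemma resolvable_parallel_classes : resolvable V blocks #|I|.
Proof.
exists [set P i | i : I]; split.
- apply/and3P; split; first by rewrite cover_imset.
    apply/trivIsetP => _ _ /imsetP[i _ ->] /imsetP[j _ ->].
    apply: contraNT; rewrite -setI_eq0 => /set0Pn[A /setIP[Ai Aj]].
    by rewrite (parallel_class_uniq Ai Aj).
  apply: contra V_neq0 => /imsetP[i _ Pi].
  by rewrite -(cover_partition (partP i)) -Pi /cover big_set0.
- rewrite card_imset // => i j eq_ij; have [x] := set0Pn _ V_neq0.
  rewrite -(cover_partition (partP i)) => /bigcupP[A Ai _].
  by apply: parallel_class_uniq (Ai) _; rewrite -eq_ij.
by move=> _ /imsetP[i _ ->].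
Qed.

Lemma card_parallel_blocks_through x :
  x \in V -> #|[set A in blocks | x \in A]| = #|I|.
Proof.
move=> xV; have cover_x i : x \in cover (P i).
  by rewrite (cover_partition (partP i)).
have -> : [set A in blocks | x \in A] = [set pblock (P i) x | i : I].
  apply/setP => A; rewrite inE.
  apply/andP/imsetP => [[/bigcupP[i _ Ai] xA]|[i _ ->]].
    by exists i; rewrite ?(def_pblock (partition_trivIset (partP i)) Ai xA).
  rewrite mem_pblock; split=> //.
  by apply/bigcupP; exists i; rewrite ?pblock_mem.
rewrite card_imset // => i j eq_ij.
apply: (@parallel_class_uniq i j (pblock (P i) x)); first exact: pblock_mem.
by rewrite eq_ij; apply: pblock_mem.
Qed.

Lemma configuration_parallel_classes :
  configuration V blocks #|V| #|I| #|blocks| k.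
Proof.
split=> //; last exact: card_parallel_blocks_through.
  move=> A /bigcupP[i _ Ai]; split; last exact: cardP Ai.
  by rewrite -(cover_partition (partP i)); apply: bigcup_sup.
move=> x y _ _ neq_xy; apply/card_le1_eqP => A B.
rewrite !inE => /and3P[/bigcupP[i _ Ai] xA yA].
move=> /and3P[/bigcupP[j _ Bj] xB yB].
have eq_ij : i = j.
  apply/eqP; apply: contraNT neq_xy => neq_ij; apply/eqP.
  by apply: (card_le1_eqP (meetP neq_ij Ai Bj)); apply/setIP.
rewrite {}eq_ij in Ai; have trivP := partition_trivIset (partP j).
by rewrite -(def_pblock trivP Ai xA) (def_pblock trivP Bj xB).
Qed.

End ParallelClasses.

(** * The Heffter space generated by base blocks *)

Lemma half_set_of_opp (G : finZmodType) (V : {set G}) : 0 \notin V ->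
  (forall x, x != 0 -> (- x \in V) = (x \notin V)) -> half_set V.
Proof.
move=> V0 oppV; have mem_opp x : (x \in [set - y | y in V]) = (- x \in V).
  apply/imsetP/idP => [[y yV ->]|xV]; first by rewrite opprK.
  by exists (- x); rewrite ?opprK.
split.
  rewrite -setI_eq0; apply/eqP/setP => x; rewrite in_setI mem_opp in_set0.
  have [->|x0] := eqVneq x 0; first by rewrite (negPf V0).
  by rewrite oppV // andbN.
apply/setP => x; rewrite in_setU mem_opp !inE; have [->|x0] := eqVneq x 0.
  by rewrite oppr0 (negPf V0).
by rewrite oppV // orbN.
Qed.

Lemma card_half_set (G : finZmodType) (V : {set G}) :
  half_set V -> #|V| = ((#|G| - 1) %/ 2)%N.
Proof.
case=> disjV unionV; have := cardsC1 (0 : G); rewrite -unionV cardsU.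
move: disjV; rewrite -setI_eq0 => /eqP ->; rewrite cards0 subn0.
by rewrite (card_imset _ oppr_inj) addnn -subn1 => <-; rewrite -muln2 mulnK.
Qed.

Lemma uniq_map_inj_in (T1 T2 : eqType) (f : T1 -> T2) (s : seq T1) :
  uniq (map f s) -> {in s &, injective f}.
Proof.
elim: s => //= z s IHs /andP[fz uniq_fs] x y; rewrite !in_cons.
case/predU1P=> [->|xs] /predU1P[->|ys] // eq_f.
- by rewrite eq_f map_f in fz.
- by rewrite -eq_f map_f in fz.
exact: IHs.
Qed.

Lemma partial_sums_scale (G : finNzRingType) (d : G) (s : seq G) :
  partial_sums [seq x * d | x <- s] = [seq x * d | x <- partial_sums s].
Proof.
rewrite /partial_sums -[X in scanl _ X _ = _](mul0r d).
by elim: s 0 => //= x s IHs y; rewrite -mulrDl IHs.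
Qed.

Section Dilates.

Variables (F : finFieldType) (e t : nat).
Hypothesis cardF : #|F| = (e * t).+1.

Implicit Types (b c : seq F) (d x y : F).

Local Notation C := (@cyclotomic_class F t).

Definition dilate b d : {set F} := [set x * d | x in b].

Definition dilates b : {set {set F}} := [set dilate b d | d in C 1].

Lemma card_dilate b d : uniq b -> d != 0 -> #|dilate b d| = size b.
Proof.
move=> uniq_b d0; rewrite card_imset; last exact: mulIf.
exact/card_uniqP.
Qed.

Lemma zero_sum_dilate b d : uniq b -> d != 0 -> \sum_(y <- b) y = 0 ->
  zero_sum (dilate b d).
Proof.
move=> uniq_b d0 sum0.
rewrite /zero_sum big_imset => [|x y _ _ /(mulIf d0)] //=.
by rewrite -mulr_suml -big_uniq //= sum0 mul0r.
Qed.

Lemma simple_dilate b d : uniq b -> d != 0 -> uniq (partial_sums b) ->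
  exists s, perm_eq s (enum (dilate b d)) /\ uniq (partial_sums s).
Proof.
move=> uniq_b d0 simple_b; have dI := mulIf d0.
exists [seq x * d | x <- b].
rewrite partial_sums_scale map_inj_uniq //; split=> //.
apply: uniq_perm; rewrite ?enum_uniq ?map_inj_uniq // => x.
by rewrite mem_enum; apply/mapP/imsetP.
Qed.

Section BaseDilates.

Variable b : seq F.
Hypothesis b0 : 0 \notin b.
Hypothesis uniq_class_b : uniq [seq y ^+ t | y <- b].

Lemma partition_dilates : b != [::] -> partition (dilates b) (class_union t b).
Proof.
move=> b_neq0; apply/and3P; split.
- apply/eqP/setP => x; rewrite inE; apply/bigcupP/mapP.
    case=> _ /imsetP[d dC ->] /imsetP[y yb ->].
    by exists y; rewrite ?exprM_class1.
  case=> y yb xy; have y0 : y != 0 by apply: contraNneq b0 => <-.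
  exists (dilate b (x / y)); last first.
    by apply/imsetP; exists y; rewrite // mulrC divfK.
  by apply: imset_f; rewrite mem_cyclotomic_class1 // inE xy.
- apply/trivIsetP => _ _ /imsetP[d dC ->] /imsetP[d' d'C ->].
  apply: contraNT; rewrite -setI_eq0 => /set0Pn[x /setIP[]].
  case/imsetP=> y yb xE /imsetP[y' y'b xE'].
  have eq_y : y = y'.
    apply: (uniq_map_inj_in uniq_class_b) => //=.
    by rewrite -(exprM_class1 y dC) -(exprM_class1 y' d'C) -xE xE'.
  have y0 : y != 0 by apply: contraNneq b0 => <-.
  by apply/eqP; congr dilate; apply: (mulfI y0); rewrite -xE xE' eq_y.
apply/imsetP => -[d _ /esym/eqP]; apply/negP/set0Pn.
case: (b) b_neq0 => // y s _.
by exists (y * d); apply: imset_f; rewrite mem_head.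
Qed.

Lemma card_dilatesI c A B : class_transversal t b c -> uniq (ratios b c) ->
  A \in dilates b -> B \in dilates c -> (#|A :&: B| <= 1)%N.
Proof.
move=> bc uniq_bc /imsetP[d dC ->] /imsetP[d' d'C ->].
have size_c := class_transversal_size bc.
have c0 := class_transversal_neq0 cardF b0 bc.
have index_of x : x \in dilate b d :&: dilate c d' ->
    exists2 i, (i < size b)%N & x = b`_i * d /\ (ratios b c)`_i = d' / d.
  case/setIP=> /imsetP[_ /(nthP 0)[i ib <-] xE].
  case/imsetP=> _ /(nthP 0)[j jc <-] xE'.
  rewrite size_c in jc.
  have eq_ij : i = j.
    apply/eqP; rewrite -(nth_uniq 0 _ _ uniq_class_b) ?size_map //.
    rewrite -{2}bc !(nth_map 0) ?size_c //.
    by rewrite -(exprM_class1 _ dC) -xE xE' (exprM_class1 _ d'C).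
  exists i => //; split=> //; rewrite nth_ratios //; apply/eqP.
  rewrite eqr_div ?(class1_neq0 cardF dC) //; last first.
    by apply: contraNneq c0 => <-; rewrite mem_nth ?size_c.
  by rewrite -xE xE' eq_ij mulrC.
apply/card_le1_eqP => x y /index_of[i ib [-> ratio_i]].
case/index_of=> j jb [-> ratio_j]; congr (b`_ _ * _); apply/eqP.
rewrite -(nth_uniq 0 _ _ uniq_bc) ?size_ratios ?size_c ?minnn //.
by rewrite ratio_i ratio_j.
Qed.

End BaseDilates.

End Dilates.

Section HeffterSpace.

Variables (F : finFieldType) (e t : nat) (a : seq F) (L : seq (seq F)).
Hypothesis cardF : #|F| = (e * t).+1.
Hypothesis size_a : (1 < size a)%N.
Hypothesis a0 : 0 \notin a.
Hypothesis uniq_class_a : uniq [seq x ^+ t | x <- a].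
Hypothesis half_set_a : half_set (class_union t a).
Hypothesis base_L : {in L, forall b, base_block t a b}.
Hypothesis ratios_L : pairwise (@distinct_ratios F) L.

Local Notation V := (class_union t a).

Definition developed_blocks : {set {set F}} :=
  \bigcup_(i < size L) dilates t (nth [::] L i).

Let base_nth (i : 'I_(size L)) : base_block t a (nth [::] L i).
Proof. by apply: base_L; apply: mem_nth. Qed.

Lemma base_block_uniq_class b : base_block t a b -> uniq [seq y ^+ t | y <- b].
Proof. by case=> ->. Qed.

Lemma base_block_uniq b : base_block t a b -> uniq b.
Proof. by move/base_block_uniq_class/map_uniq. Qed.

Lemma mem_developed_blocks A : A \in developed_blocks ->
  exists b d,
    [/\ base_block t a b, d \in cyclotomic_class t 1 & A = dilate b d].
Proof.
case/bigcupP=> i _ /imsetP[d dC ->].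
by exists (nth [::] L i), d; split.
Qed.

Lemma partition_base_dilates b : base_block t a b -> partition (dilates t b) V.
Proof.
move=> base_b; have [ab _ _] := base_b.
rewrite -(class_union_transversal ab).
apply: partition_dilates.
- exact: (class_transversal_neq0 cardF a0 ab).
- exact: base_block_uniq_class base_b.
by rewrite -size_eq0 (class_transversal_size ab) -lt0n ltnW.
Qed.

Lemma card_developed_block A : A \in developed_blocks -> #|A| = size a.
Proof.
case/mem_developed_blocks=> b [d [base_b dC ->]].
have [ab _ _] := base_b; rewrite card_dilate ?(class_transversal_size ab) //.
  exact: base_block_uniq base_b.
exact: (class1_neq0 cardF dC).
Qed.

Lemma card_developed_blocksI (i j : 'I_(size L)) A B : i != j ->
  A \in dilates t (nth [::] L i) -> B \in dilates t (nth [::] L j) ->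
  (#|A :&: B| <= 1)%N.
Proof.
move=> neq_ij; have [ab _ _] := base_nth i; have [ac _ _] := base_nth j.
apply: (card_dilatesI cardF); first exact: (class_transversal_neq0 cardF a0 ab).
- exact/base_block_uniq_class/base_nth.
- by rewrite /class_transversal ab ac.
have /(pairwiseP [::]) ratios_nth := ratios_L.
case: (ltngtP i j) neq_ij => [lt_ij|lt_ji|/val_inj->]; last by rewrite eqxx.
  by move=> _; apply: ratios_nth; rewrite ?inE.
by move=> _; rewrite ratiosC_uniq; apply: ratios_nth; rewrite ?inE.
Qed.

Lemma heffter_space_developed_blocks :
  heffter_space V developed_blocks ((#|F| - 1) %/ 2) (size a) (size L).
Proof.
have V_neq0 : V != set0.
  have head_a : head 0 a \in a by case: a size_a => //= x s _; apply: mem_head.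
  apply/set0Pn; exists (head 0 a); rewrite inE.
  exact: (map_f (fun x => x ^+ t)).
have part_L (i : 'I_(size L)) : partition (dilates t (nth [::] L i)) V.
  exact/partition_base_dilates/base_nth.
have card_L (i : 'I_(size L)) A :
    A \in dilates t (nth [::] L i) -> #|A| = size a.
  by move=> Ai; apply/card_developed_block/bigcupP; exists i.
rewrite -(card_half_set half_set_a) -[size L]card_ord; split=> //.
- exists #|developed_blocks|.
  exact: (configuration_parallel_classes part_L size_a card_L
            card_developed_blocksI).
- exact: (resolvable_parallel_classes V_neq0 part_L size_a card_L
            card_developed_blocksI).
move=> _ /mem_developed_blocks[b [d [base_b dC ->]]].
have [_ sum_b _] := base_b.
apply: zero_sum_dilate => //; first exact: base_block_uniq base_b.
exact: (class1_neq0 cardF dC).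
Qed.

Lemma simple_developed_blocks : simple_blocks developed_blocks.
Proof.
move=> _ /mem_developed_blocks[b [d [base_b dC ->]]].
have [_ _ simple_b] := base_b.
apply: simple_dilate => //; first exact: base_block_uniq base_b.
exact: (class1_neq0 cardF dC).
Qed.

End HeffterSpace.

Lemma prim_root_half_exp (D : idomainType) (k : nat) (w : D) :
  (2 * k).-primitive_root w -> w ^+ k = -1.
Proof.
move=> prim_w; have k_gt0 := prim_order_gt0 prim_w.
have /eqP : (w ^+ k) ^+ 2 = 1 by rewrite -exprM mulnC prim_expr_order.
rewrite -[X in _ == X](expr1n _ 2) eqf_sqr => /orP[|/eqP //].
by rewrite -(prim_order_dvd prim_w) => /dvdn_leq; lia.
Qed.

Section PowerRepresentatives.

Variables (F : finFieldType) (k t : nat) (g : F).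
Hypothesis prim_g : (2 * k * t).-primitive_root g.
Hypothesis cardF : #|F| = (2 * k * t).+1.

Lemma prim_root_exp_index : (2 * k).-primitive_root (g ^+ t).
Proof.
have /andP[k2_gt0 _] := index_order_gt0 cardF.
by have := dvdn_prim_root prim_g (dvdn_mulr t (dvdnn (2 * k))); rewrite mulKn.
Qed.

Let g_neq0 : g != 0.
Proof. by rewrite (prim_root_eq0 prim_g) -lt0n (prim_order_gt0 prim_g). Qed.

Lemma powers_neq0 n : 0 \notin mkseq (GRing.exp g) n.
Proof. by apply/mapP => -[i _ /esym/eqP]; apply/negP; rewrite expf_neq0. Qed.

Lemma map_exp_powers n :
  [seq x ^+ t | x <- mkseq (GRing.exp g) n] = mkseq (GRing.exp (g ^+ t)) n.
Proof. by rewrite -map_comp; apply: eq_map => i /=; apply: exprAC. Qed.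

Lemma uniq_class_powers n : (n <= 2 * k)%N ->
  uniq [seq x ^+ t | x <- mkseq (GRing.exp g) n].
Proof.
move=> le_n; rewrite map_exp_powers; apply/mkseq_uniqP => i j.
rewrite !inE => i_n j_n /eqP; rewrite (eq_prim_root_expr prim_root_exp_index).
by rewrite !modn_small ?(leq_trans _ le_n) // => /eqP.
Qed.

Lemma half_set_class_powers :
  odd t -> half_set (class_union t (mkseq (GRing.exp g) k)).
Proof.
move=> t_odd; set V := class_union _ _; have prim_w := prim_root_exp_index.
have memV x n : x ^+ t = g ^+ t ^+ n -> (x \in V) = (n %% (2 * k) < k)%N.
  move=> xn; rewrite inE map_exp_powers xn; apply/mapP/idP => [[i + /eqP]|lt_n].
    rewrite mem_iota (eq_prim_root_expr prim_w) => i_k /eqP->.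
    by rewrite modn_small //; lia.
  by exists (n %% (2 * k))%N; rewrite ?mem_iota //= prim_expr_mod.
have opp_exp x : (- x) ^+ t = g ^+ t ^+ k * x ^+ t.
  by rewrite exprNn -signr_odd t_odd (prim_root_half_exp prim_w).
apply: half_set_of_opp => [|x x0].
  exact/(class_union0 cardF)/powers_neq0.
have [n xn] : exists n : 'I_(2 * k), x ^+ t = g ^+ t ^+ n.
  have [|n xn] := prim_rootP prim_w (x := x ^+ t); last by exists n.
  rewrite -exprM mulnC; apply: (mulIf x0).
  by rewrite -exprSr -cardF expf_card mul1r.
rewrite (memV x n xn) (memV (- x) (k + n)%N); last by rewrite opp_exp xn exprD.
have n_lt := ltn_ord n; rewrite (modn_small n_lt); case: (ltnP n k) => n_k.
  by rewrite modn_small; lia.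
have -> : (k + n = n - k + 2 * k)%N by lia.
by rewrite modnDr modn_small; lia.
Qed.

Lemma exists_power_base_blocks (R : realType) (r : nat) :
  (3 <= k)%N -> heffter_Q R k r < #|F|%:R ->
  exists L, [/\ size L = r,
    {in L, forall b, base_block t (mkseq (GRing.exp g) k) b}
    & pairwise (@distinct_ratios F) L].
Proof.
move=> k_ge3 Q_lt; pose reps := mkseq (GRing.exp g); pose m := (k - 2)%N.
have repsE : reps k = rcons (rcons (reps m) (g ^+ m)) (g ^+ m.+1).
  by rewrite -!mkseqS /m; congr mkseq; lia.
rewrite -/(reps k) repsE; apply: (exists_base_blocks cardF).
- by rewrite -size_eq0 size_mkseq /m; lia.
- by rewrite -repsE; apply: powers_neq0.
move=> s s0; rewrite size_mkseq.
have := heffter_n_lt_cyclotomic_number (a := g ^+ m) (b := - g ^+ m.+1)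
  cardF Q_lt _ _ s0.
rewrite oppr_eq0 !expf_neq0 // /heffter_n => /(_ isT isT).
by rewrite /m; set N := cyclotomic_number _ _ _ _; lia.
Qed.

End PowerRepresentatives.

Lemma odd_cofactor (k q : nat) :
  (0 < k)%N -> (q = 2 * k + 1 %[mod 4 * k])%N ->
  exists2 t, odd t & q = (2 * k * t).+1.
Proof.
move=> k_gt0 q_mod; exists (2 * (q %/ (4 * k))).+1.
  by rewrite /= mul2n odd_double.
by rewrite {1}(divn_eq q (4 * k)) q_mod modn_small; lia.
Qed.

Theorem theorem3p1 (R : realType) (k r : nat) (hk : (3 <= k)%N)
    (q : nat) (hq : prime_power q)
    (hmod : (q = 2 * k + 1 %[mod 4 * k])%N)
    (hQ : heffter_Q R k r < q%:R) :
  exists (G : finZmodType) (V : {set G}) (B : {set {set G}}),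
    heffter_space V B ((q - 1) %/ 2)%N k r /\ simple_blocks B.
Proof.
have [t t_odd qt] := odd_cofactor (ltnW (ltnW hk)) hmod.
have [p [m [p_pr m_gt0 qE]]] := hq.
have [F _] := pPrimePowerField p_pr m_gt0; rewrite -qE => cardFq.
have cardF : #|F| = (2 * k * t).+1 by rewrite cardFq.
have [g prim_g] := finField_prim_root F; rewrite cardF /= in prim_g.
rewrite -cardFq in hQ *; set reps := mkseq (GRing.exp g) k.
have [L [<- base_L ratios_L]] := exists_power_base_blocks prim_g cardF hk hQ.
have size_reps : size reps = k := size_mkseq _ _.
have reps_gt1 : (1 < size reps)%N by rewrite size_reps ltnW.
have reps0 : 0 \notin reps := powers_neq0 prim_g k.
have uniq_reps := uniq_class_powers prim_g cardF (leq_pmull k (ltn0Sn 1)).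
exists F, (class_union t reps), (developed_blocks t L); split; last first.
  exact: (simple_developed_blocks cardF uniq_reps base_L).
rewrite -[X in heffter_space _ _ _ X]size_reps.
apply: (heffter_space_developed_blocks cardF) => //.
exact: (half_set_class_powers prim_g cardF t_odd).
Qed.
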